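(* For all $n\in\mathbb{N}$, $q(n)\ge 1.236^{\,n-o(n)}$.
   Context: Let $X_n=\{x_1,\dots,x_n\}$. A decision tree over $X_n$ is a binary tree whose internal nodes are labeled by queries $Q\subseteq X_n$ (with outgoing edges ''Yes'' meaning $x\in Q$ and ''No'' meaning $x\notin Q$) and whose leaves are labeled by elements of $X_n$, each element labeling at most one leaf; it uses $\mathcal{Q}\subseteq2^{X_n}$ if all its queries lie in $\mathcal{Q}$. It is valid for a distribution $\pi$ on $X_n$ if every element of the support of $\pi$ labels a leaf, and its cost is $\sum_i\pi(x_i)\cdot(\text{depth of }x_i)$. $\mathrm{Opt}(\pi)$ is the minimum cost of a valid decision tree for $\pi$. A set $\mathcal{Q}\subseteq2^{X_n}$ is optimal if for every distribution $\pi$ on $X_n$ some valid decision tree using $\mathcal{Q}$ has cost $\mathrm{Opt}(\pi)$. $q(n)$ is the minimum cardinality of an optimal set of queries over $X_n$. *)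

(* Defs.v *)
From HB Require Import structures.
From mathcomp Require Import all_boot all_order all_algebra.
From mathcomp Require Import all_classical all_reals all_analysis.

Set Implicit Arguments.
Unset Strict Implicit.
Unset Printing Implicit Defensive.

Import Order.TTheory GRing.Theory Num.Theory.

Local Open Scope ring_scope.

(* [Node Q Y N] branches to Y on the elements of Q and to N on the others. *)
Inductive dtree (n : nat) : Type :=
  | Leaf of 'I_n
  | Node of {set 'I_n} & dtree n & dtree n.

Section Trees.
Variable n : nat.
Implicit Types (T : dtree n) (x : 'I_n) (F : {set {set 'I_n}}).

Fixpoint leaves T : seq 'I_n :=
  match T with
  | Leaf x => [:: x]
  | Node _ Y N => leaves Y ++ leaves N
  end.

(* An element labelling a leaf must reach that leaf by answering the queries
   truthfully; otherwise the queries would put no constraint on the tree. *)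
Fixpoint consistent T : bool :=
  match T with
  | Leaf _ => true
  | Node Q Y N =>
      [&& all (fun x => x \in Q) (leaves Y),
          all (fun x => x \notin Q) (leaves N),
          consistent Y & consistent N]
  end.

Definition is_decision_tree T : bool := uniq (leaves T) && consistent T.

Fixpoint uses F T : bool :=
  match T with
  | Leaf _ => true
  | Node Q Y N => [&& Q \in F, uses F Y & uses F N]
  end.

(* Meaningful only for [x \in leaves T]. *)
Fixpoint depth T x : nat :=
  match T with
  | Leaf _ => 0
  | Node _ Y N => (if x \in leaves Y then depth Y x else depth N x).+1
  end.

Lemma uses_setT T : uses [set: {set 'I_n}] T.
Proof. by elim: T => //= Q Y -> N ->; rewrite inE. Qed.

Lemma depth_lt_size_leaves T x : (depth T x < size (leaves T))%N.
Proof.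
elim: T => //= Q Y IHY N IHN; rewrite size_cat.
have Y0 := leq_ltn_trans (leq0n _) IHY; have N0 := leq_ltn_trans (leq0n _) IHN.
case: ifP => _; first by have := leq_add IHY N0; rewrite addn1.
by have := leq_add Y0 IHN; rewrite add1n.
Qed.

Lemma depth_lt T x : is_decision_tree T -> (depth T x < n)%N.
Proof.
case/andP=> uT _; apply: leq_trans (depth_lt_size_leaves T x) _.
by rewrite -(card_uniqP uT) -[leqRHS]card_ord max_card.
Qed.

Fixpoint chain x (s : seq 'I_n) : dtree n :=
  if s is y :: s' then Node [set x] (Leaf x) (chain y s') else Leaf x.

Lemma leaves_chain x s : leaves (chain x s) = x :: s.
Proof. by elim: s x => //= y s IHs x; rewrite IHs. Qed.

Lemma chain_decision_tree x s : uniq (x :: s) -> is_decision_tree (chain x s).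
Proof.
elim: s x => //= y s IHs x /andP[xNs us].
have /andP[_ cs] := IHs y us.
rewrite /is_decision_tree /= leaves_chain [uniq _]us xNs cs set11 !andbT.
apply/(allP (s := y :: s)) => z zs; rewrite inE.
by apply: contraNneq xNs => <-.
Qed.

Lemma full_decision_tree x :
  exists2 T, is_decision_tree T & forall y, y \in leaves T.
Proof.
case E: (enum 'I_n) => [|z s]; first by have := mem_enum 'I_n x; rewrite E.
exists (chain z s); first by apply: chain_decision_tree; rewrite -E enum_uniq.
by move=> y; rewrite leaves_chain -E mem_enum.
Qed.

End Trees.

Section Optimality.
Variables (R : realType) (n : nat).
Implicit Types (p : {ffun 'I_n -> R}) (T : dtree n) (F : {set {set 'I_n}}).

Definition is_distribution p : Prop :=
  (forall x, 0 <= p x) /\ \sum_x p x = 1.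

Definition valid p T : Prop :=
  is_decision_tree T /\ forall x, p x != 0 -> x \in leaves T.

Definition cost p T : R := \sum_x p x * (depth T x)%:R.

(* The infimum is attained, see [Opt_attained]. *)
Definition Opt p : R := inf [set cost p T | T in valid p]%classic.

Definition optimal F : Prop :=
  forall p, is_distribution p ->
  exists T, [/\ valid p T, uses F T & cost p T = Opt p].

Lemma Opt_attained p : is_distribution p ->
  exists2 T, valid p T & cost p T = Opt p.
Proof.
move=> [p_ge0 p_sum].
have [x0 _] : exists x0 : 'I_n, True.
  case: (pickP 'I_n) => [x _|no]; first by exists x.
  by move: p_sum; rewrite big_pred0 // => /esym/eqP; rewrite oner_eq0.
pose P (d : {ffun 'I_n -> 'I_n}) :=
  `[< exists2 T, valid p T & forall x, depth T x = d x >].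
pose c (d : {ffun 'I_n -> 'I_n}) : R := \sum_x p x * (d x)%:R.
have ofT T : valid p T -> exists2 d, P d & cost p T = c d.
  move=> vT; pose d := [ffun x => Ordinal (depth_lt x (proj1 vT))].
  exists d; first by apply/asboolP; exists T => // x; rewrite ffunE.
  by apply: eq_bigr => x _; rewrite ffunE.
have [T0 dT0 fT0] := full_decision_tree x0.
have [d0 Pd0 _] : exists2 d, P d & cost p T0 = c d by apply: ofT; split.
case: (arg_minP c Pd0) => d /asboolP[T vT Td] dmin.
have cT : cost p T = c d by apply: eq_bigr => x _; rewrite Td.
have lbT : lbound [set cost p T | T in valid p]%classic (cost p T).
  by move=> _ [T' /ofT[d' Pd' ->] <-]; rewrite cT dmin.
exists T => //; apply/le_anti/andP; split.
  by apply: lb_le_inf => //; exists (cost p T), T.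
by apply: ge_inf; [exists (cost p T) | exists T].
Qed.

Lemma optimal_setT : optimal [set: {set 'I_n}].
Proof.
by move=> p /Opt_attained[T vT cT]; exists T; split=> //; apply: uses_setT.
Qed.

Lemma optimal_card_ex :
  exists m, `[< exists2 F, optimal F & #|F| = m >].
Proof.
exists #|[set: {set 'I_n}]|; apply/asboolP.
by exists [set: {set 'I_n}]; first exact: optimal_setT.
Qed.

Definition q : nat := ex_minn optimal_card_ex.

End Optimality.

(* Main.v *)
(* If F is optimal and pi is dyadic with full support, a tree of cost Opt(pi) gives each
   element x the depth -log2 pi(x), so its root query has probability exactly 1/2.
   Colour X_n at random: a elements get 2 units of mass, b get 1 unit, and the others
   share one unit geometrically, with 2a + b + 1 = 2T and T a power of two.  A query of
   probability 1/2, or its complement, avoids the geometric part and collects T units.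
   Weighting an element of colour k by g_k u^k inside the query and by g_k u^-k outside,
   with both families of total mass at most 1, bounds by 1/G the number of colourings
   split by a fixed query, where G is the product of the g_k over the elements.  Hence
   2 |F| is at least G times a multinomial coefficient.  As T is a power of two, 2T/n can
   only be prescribed up to a factor 2, and a/n and b/n have to follow it over an octave;
   for a fixed choice of g and u the exponential rate is concave in (a/n, b/n), so that
   rational certificates at the ends of five intervals suffice.  The worst rate that this
   method gives is sqrt 5 - 1 = 1.23606..., barely above 1.236. *)

Require Import Defs.
From Stdlib Require Import BinNat Nnat.
From mathcomp Require Import all_boot all_order all_algebra.
From mathcomp Require Import all_classical all_reals all_analysis.
(* Imported again because the analysis library shadows their set lemmas. *)
From mathcomp Require Import fintype finset zify ring lra.
Import Order.TTheory GRing.Theory Num.Theory numFieldNormedType.Exports.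

Set Implicit Arguments.
Unset Strict Implicit.
Unset Printing Implicit Defensive.

(** * Binomial coefficients *)

(** From [a] to [k] the factorial gains factors at least [a] if [k] is larger, and loses factors at
    most [a] if it is smaller. *)
Lemma fact_exp_leq a k : a`! * a ^ k <= k`! * a ^ a.
Proof.
have up j c k' : c <= k' -> k'`! * c ^ j <= (k' + j)`!.
  move=> ck; elim: j => [|j IHj]; first by rewrite addn0 muln1.
  by rewrite addnS factS expnS mulnCA leq_mul //; lia.
have down j c k' : k' + j <= c -> (k' + j)`! <= k'`! * c ^ j.
  elim: j => [|j IHj] kc; first by rewrite addn0 muln1.
  by rewrite addnS factS expnS mulnCA leq_mul ?IHj //; lia.
have [/subnKC <-|/ltnW/subnKC <-] := leqP k a.
  rewrite [X in _ <= _ * X]expnD mulnCA [leqLHS]mulnC leq_mul //.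
  exact: down.
by rewrite expnD mulnCA [leqRHS]mulnC leq_mul // up.
Qed.

(* [a] is the mode of the binomial distribution with parameters [a + b] and [a / (a + b)]. *)
Lemma bin_mode a b :
  (a + b) ^ (a + b) <= (a + b).+1 * ('C(a + b, a) * (a ^ a * b ^ b)).
Proof.
set n := a + b; rewrite {1}/n expnDn -/n.
rewrite -[X in X * _](card_ord n.+1) -sum_nat_const; apply: leq_sum => i _.
have ni : i <= n by rewrite -ltnS ltn_ord.
have an : a <= n by rewrite leq_addr.
have f0 : 0 < i`! * (n - i)`! * (a`! * b`!) by rewrite !muln_gt0 !fact_gt0.
(* Each term of the binomial expansion is compared with the term at the mode; clearing factorials
   leaves two uses of [fact_exp_leq]. *)
rewrite -(leq_pmul2r f0).
have -> : 'C(n, i) * (a ^ (n - i) * b ^ i) * (i`! * (n - i)`! * (a`! * b`!))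
   = n`! * ((a`! * a ^ (n - i)) * (b`! * b ^ i)).
  by rewrite -(bin_fact ni); ring.
have -> : 'C(n, a) * (a ^ a * b ^ b) * (i`! * (n - i)`! * (a`! * b`!))
   = n`! * (((n - i)`! * a ^ a) * (i`! * b ^ b)).
  by rewrite -(bin_fact an) /n addKn; ring.
by apply: leq_mul => //; apply: leq_mul; apply: fact_exp_leq.
Qed.

Lemma bin_mode_scaled m a b :
  ((a + b) ^ (a + b)) ^ m <=
  (m * (a + b)).+1 * ('C(m * (a + b), m * a) * (a ^ a * b ^ b) ^ m).
Proof.
have [->|m0] := posnP m; first by rewrite !expn0 mul0n bin0.
have p0 : 0 < m ^ (m * (a + b)) by rewrite expn_gt0 m0.
have := bin_mode (m * a) (m * b); rewrite -mulnDr => mode.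
rewrite -(leq_pmul2r p0) -!expnM expnMn -expnM [_ * m]mulnC -expnMn [_ * m]mulnC.
apply: leq_trans mode _; rewrite !expnMn mulnDr expnD -!expnM [a * m]mulnC [b * m]mulnC.
by apply: eq_leq; ring.
Qed.

(** Two uses of [bin_mode_scaled]: [a] against [b + c], then [b] against [c]. *)
Lemma multinomial_block m a b c N : a + b + c = N ->
  (N ^ N) ^ m <=
  (m * N).+1 ^ 2 * ('C(m * N, m * a) * 'C(m * (N - a), m * b))
  * (a ^ a * b ^ b * c ^ c) ^ m.
Proof.
move=> NE; have := bin_mode_scaled m a (b + c); rewrite addnA NE => h1.
have := bin_mode_scaled m b c => h2.
have -> : N - a = b + c by rewrite -NE -addnA addKn.
set P := ((b + c) ^ (b + c)) ^ m in h2.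
rewrite expnMn -/P in h1.
apply: leq_trans h1 _; rewrite !expnMn in h2 *.
rewrite [leqRHS](_ : _ = (m * N).+1 * ('C(m * N, m * a) * ((a ^ a) ^ m *
  ((m * N).+1 * ('C(m * (b + c), m * b) * ((b ^ b) ^ m * (c ^ c) ^ m)))))); last by ring.
rewrite !leq_mul //; apply: leq_trans h2 _.
by rewrite leq_mul // ltnS leq_mul //; lia.
Qed.

(** One term of Vandermonde's convolution; it plays the role of concavity when blocks are put
    together. *)
Lemma bin_super n k n' k' : 'C(n, k) * 'C(n', k') <= 'C(n + n', k + k').
Proof.
rewrite -binomial.Vandermonde.
have kk : k < (k + k').+1 by lia.
by rewrite (bigD1 (Ordinal kk)) //= addKn leq_addr.
Qed.

Local Open Scope ring_scope.

(** * Dyadic distributions *)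

Section DyadicTrees.
Variables (R : realType) (n : nat).
Implicit Types (T : dtree n) (x : 'I_n) (S Q : {set 'I_n}) (l : 'I_n -> nat).

Local Notation half := (2^-1 : R).

Lemma half_exp_gt0 k : 0 < half ^+ k.
Proof. by rewrite exprn_gt0 // invr_gt0. Qed.

Lemma half_expS k : half ^+ k.+1 + half ^+ k.+1 = half ^+ k.
Proof. by rewrite exprS; field. Qed.

Lemma kraft T : is_decision_tree T ->
  \sum_(x <- leaves T) half ^+ depth T x = 1.
Proof.
elim: T => [x|Q Y IHY N IHN] /=; first by rewrite big_seq1 expr0.
case/andP => /=; rewrite cat_uniq => /and3P[uY dYN uN] /and4P[_ _ cY cN].
rewrite big_cat /= (eq_big_seq (fun x => half * half ^+ depth Y x)); last first.
  by move=> x xY; rewrite xY exprS.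
rewrite -big_distrr IHY; last by rewrite /is_decision_tree uY.
rewrite (eq_big_seq (fun x => half * half ^+ depth N x)); last first.
  move=> x xN; rewrite ifN ?exprS //.
  by apply: contra dYN => xY; apply/hasP; exists x.
rewrite -big_distrr IHN; last by rewrite /is_decision_tree uN.
by rewrite /=; field.
Qed.

(** An element of weight [half ^+ k] suffices if there is one. Otherwise all weights are at most
    half of that, and two disjoint sets of mass [half ^+ k.+1] are extracted in turn. *)
Lemma dyadic_subset l j k S :
  (forall x, x \in S -> k <= l x <= k + j)%N ->
  half ^+ k <= \sum_(x in S) half ^+ l x ->
  exists2 A : {set 'I_n}, A \subset S & \sum_(x in A) half ^+ l x = half ^+ k.
Proof.
elim: j k S => [|j IHj] k S lS sumS.
all: have [/exists_inP[x xS /eqP lx]|/exists_inPn no] :=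
  boolP [exists x in S, l x == k];
  try by exists [set x]; rewrite ?sub1set // big_set1 lx.
  move: sumS; rewrite big_pred0 ?leNgt ?half_exp_gt0 // => x.
  apply/negP => xS; have := lS x xS; rewrite addn0 -eqn_leq eq_sym => lx.
  by case/negP: (no x xS).
have lS' x : x \in S -> (k.+1 <= l x <= k.+1 + j)%N.
  by move=> xS; have := no x xS; have := lS x xS; lia.
have [|A AS sumA] := IHj _ _ lS'.
  by rewrite (le_trans _ sumS) // -(half_expS k) lerDl ltW ?half_exp_gt0.
have [||B BS sumB] := IHj k.+1 (S :\: A).
- by move=> x; rewrite inE => /andP[_ /lS'].
- by move: sumS; rewrite -(half_expS k) (big_setID A) (setIidPr AS) /= sumA lerD2l.
exists (A :|: B).
  by rewrite subUset AS (subset_trans BS) ?subsetDl.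
rewrite -(half_expS k) -{1}sumA -sumB -bigU; last first.
  by rewrite (disjointWr BS) // disjoint_sym disjoints_subset subsetDr.
by apply: eq_bigl => x; rewrite !inE.
Qed.

Lemma dyadic_leaf l k S x :
  x \in S -> l x = k -> \sum_(y in S) half ^+ l y = half ^+ k -> S = [set x].
Proof.
move=> xS lx sumS; apply/eqP; rewrite eqEsubset sub1set xS andbT.
apply/subsetP => y yS; rewrite inE; apply: contraT => yx.
move: sumS; rewrite (bigD1 x) //= lx (bigD1 y) ?yS //=.
rewrite -[RHS]addr0 => /addrI/eqP; rewrite gt_eqF //.
by rewrite ltr_pwDl ?half_exp_gt0 // sumr_ge0 // => z _; rewrite ltW ?half_exp_gt0.
Qed.

(** A converse of Kraft's equality: unless [S] is a single leaf, [dyadic_subset] halves it, and that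
    half serves as the query. *)
Lemma dyadic_tree l j k S :
  (forall x, x \in S -> k <= l x <= k + j)%N ->
  \sum_(x in S) half ^+ l x = half ^+ k ->
  exists T, [/\ is_decision_tree T, leaves T =i S
              & forall x, x \in S -> (depth T x + k)%N = l x].
Proof.
elim: j k S => [|j IHj] k S lS sumS.
all: have [/exists_inP[x xS /eqP lx]|/exists_inPn no] :=
  boolP [exists x in S, l x == k];
  try by exists (Leaf x); rewrite (dyadic_leaf xS lx sumS); split=> // y;
     rewrite !inE // => /eqP->.
  move: sumS; rewrite big_pred0 => [/eqP|x]; first by rewrite lt_eqF ?half_exp_gt0.
  apply/negP => xS; have := lS x xS; rewrite addn0 -eqn_leq eq_sym => lx.
  by case/negP: (no x xS).
have lS' x : x \in S -> (k.+1 <= l x <= k.+1 + j)%N.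
  by move=> xS; have := no x xS; have := lS x xS; lia.
have [|A AS sumA] := dyadic_subset lS'.
  by rewrite sumS -(half_expS k) lerDl ltW ?half_exp_gt0.
have sumB : \sum_(x in S :\: A) half ^+ l x = half ^+ k.+1.
  apply: (@addrI _ (half ^+ k.+1)).
  by rewrite half_expS -sumS [RHS](big_setID A) (setIidPr AS) /= sumA.
have [|Y [/andP[uY cY] YA dY]] := IHj k.+1 A _ sumA.
  by move=> x xA; apply: lS'; apply: (subsetP AS).
have [|N [/andP[uN cN] NB dN]] := IHj k.+1 (S :\: A) _ sumB.
  by move=> x; rewrite inE => /andP[_ /lS'].
exists (Node A Y N); split=> [|x|x xS] /=.
- rewrite /is_decision_tree /= cat_uniq uY uN cY cN !andbT /=.
  apply/and3P; split.
  + by apply/hasPn => x; rewrite NB inE => /andP[xA _]; rewrite /= YA.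
  + by apply/allP => x; rewrite YA.
  + by apply/allP => x; rewrite NB inE => /andP[].
- rewrite mem_cat YA NB inE.
  by case: (boolP (x \in A)) => //= xA; rewrite (subsetP AS).
- rewrite YA; case: ifP => xA; first by rewrite addSnnS dY.
  by rewrite addSnnS dN // inE xA.
Qed.

End DyadicTrees.

Section OptimalSplit.
Variables (R : realType) (n : nat).
Local Notation half := (2^-1 : R).

(* [2^-k + k - 1 >= 0] for every integer [k = a - b], with equality only for
   [k = 0] and [k = -1]. *)
Lemma half_exp_convex (a b : nat) :
  half ^+ b * (b%:R + 1) <= half ^+ a + half ^+ b * a%:R
  ?= iff (a <= b <= a.+1)%N.
Proof.
have hb := half_exp_gt0 R b.
case: (ltnP b a) => [/subnKC|/subnKC] <-.
  move: (a - b.+1)%N => {a} k.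
  rewrite /=; apply/leifP.
  rewrite addSn -addnS exprD natrD -(natr1 k).
  have := half_exp_gt0 R k.+1; have : 0 <= k%:R :> R by [].
  nra.
rewrite /=; move: (b - a)%N => {b hb} [|[|k]].
- by rewrite addn0 leqnSn; apply/leifP/eqP; ring.
- by rewrite addn1 leqnn; apply/leifP/eqP; rewrite exprS -(natr1 a); field.
have -> : (a + k.+2 <= a.+1)%N = false by lia.
apply/leifP.
have ha := half_exp_gt0 R a; have hk := half_exp_gt0 R k.+2.
have h2 : half ^+ k.+2 * (k.+2%:R + 1) < 1.
  elim: k {hk} => [|k IHk]; first by rewrite exprS expr1; lra.
  have := half_exp_gt0 R k.+2; have : 0 <= k%:R :> R by [].
  move: IHk; rewrite [half ^+ k.+3]exprS -(natr1 k.+2) -(natr1 k.+1) -(natr1 k).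
  nra.
rewrite exprD natrD; move: h2 ha hk.
set u := half ^+ a; set v := half ^+ k.+2; nra.
Qed.

(** A tree of depths [l] bounds the optimum by the entropy. Summing [half_exp_convex] with Kraft's
    equality gives the reverse bound, and its equality case fixes the depths in any optimal tree. *)
Lemma optimal_split (F : {set {set 'I_n}}) (l : 'I_n -> nat) :
  optimal R F -> (1 < n)%N -> \sum_x half ^+ l x = 1 ->
  exists2 Q, Q \in F & \sum_(x in Q) half ^+ l x = half.
Proof.
move=> optF n1 suml.
pose p := [ffun x : 'I_n => half ^+ l x].
have pE x : p x = half ^+ l x by rewrite ffunE.
have p0 x : 0 < p x by rewrite pE half_exp_gt0.
have dp : is_distribution p.
  by split=> [x|]; [exact/ltW | under eq_bigr do rewrite pE].
have [T [[dT vT] uT cT]] := optF p dp.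
have inT x : x \in leaves T by rewrite vT // gt_eqF.
have [T0 [dT0 lT0 T0l]] : exists T, [/\ is_decision_tree T, leaves T =i [set: 'I_n]
              & forall x, x \in [set: 'I_n] -> (depth T x + 0)%N = l x].
  apply: (@dyadic_tree R n l (\max_x l x)%N 0 setT).
    by move=> x _; rewrite add0n leq_bigmax.
  by rewrite expr0 -[RHS]suml; apply: eq_bigl => x; rewrite inE.
have cost_le : cost p T <= \sum_x half ^+ l x * (l x)%:R.
  rewrite cT; apply: ge_inf.
    exists 0 => _ [T' _ <-]; apply: sumr_ge0 => x _.
    by rewrite mulr_ge0 // ltW.
  exists T0; first by split=> // x _; rewrite lT0 inE.
  by apply: eq_bigr => x _; rewrite pE -(T0l x) ?inE // addn0.
have := kraft R dT.
have -> : \sum_(x <- leaves T) half ^+ depth T x = \sum_x half ^+ depth T x.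
  rewrite -[RHS]big_enum; apply: perm_big; apply: uniq_perm.
  - by case/andP: dT.
  - exact: enum_uniq.
  - by move=> x; rewrite mem_enum inT.
move=> kT.
have dl x : depth T x = l x.
  have cvx : \sum_x half ^+ l x * ((l x)%:R + 1) <=
      \sum_x (half ^+ depth T x + half ^+ l x * (depth T x)%:R)
      ?= iff [forall x, depth T x <= l x <= (depth T x).+1]%N.
    by apply: leif_sum => y _; apply: half_exp_convex.
  have /eqP : \sum_x half ^+ l x * ((l x)%:R + 1) =
      \sum_x (half ^+ depth T x + half ^+ l x * (depth T x)%:R).
    apply/le_anti; rewrite cvx.1 /= big_split /= kT.
    under [leRHS]eq_bigr do rewrite mulrDr mulr1.
    rewrite big_split /= suml addrC lerD2r.
    suff <- : cost p T = \sum_x half ^+ l x * (depth T x)%:R by [].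
    by apply: eq_bigr => y _; rewrite pE.
  (* Equality leaves the depths [l x] and [l x - 1]; as both families of weights sum to 1, the
     smaller one never occurs. *)
  rewrite cvx.2 => /forallP dle.
  have d0 : \sum_x (half ^+ depth T x - half ^+ l x) = 0.
    by rewrite sumrB kT suml subrr.
  have [h0 h1] : 0 < half /\ half < 1 by split; lra.
  have ge0 y : true -> 0 <= half ^+ depth T y - half ^+ l y.
    by move=> _; rewrite subr_ge0 ler_wiXn2l ?ltW //; case/andP: (dle y).
  have /subr0_eq := psumr_eq0P ge0 d0 (isT : xpredT x).
  by apply: ieexprIn => //; rewrite lt_eqF.
case: T {cT} dT vT inT uT kT dl cost_le => [y|Q Y N].
  move=> _ _ inT; have := inT (Ordinal n1); have := inT (Ordinal (ltnW n1)).
  by rewrite !inE => /eqP <- /eqP.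
case/andP=> /=; rewrite cat_uniq => /and3P[uY dYN uN] /and4P[aY aN cY cN] _ inT.
case/and3P=> QF _ _ _ dl _; exists Q => //.
have QY : Q =i leaves Y.
  move=> x; apply/idP/idP => [xQ|]; last by move/(allP aY).
  have := inT x; rewrite mem_cat; case/orP=> // /(allP aN); by rewrite xQ.
rewrite (eq_bigr (fun x => half * half ^+ depth Y x)); last first.
  by move=> x; rewrite QY -dl exprS => ->.
rewrite -big_distrr /= -[RHS]mulr1; congr (_ * _).
rewrite -[RHS](@kraft R _ Y); last exact/andP.
rewrite -[LHS]big_enum; apply: perm_big; apply: uniq_perm => //.
  exact: enum_uniq.
by move=> x; rewrite mem_enum QY.
Qed.
End OptimalSplit.

(** * Colourings *)

(* The colour of an element is its probability in units of [2^-(K+1)], except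
   that the elements of colour 0 share one unit geometrically. *)
Section Colourings.
Variables (R : realType) (n : nat).
Implicit Types (f : {ffun 'I_n -> 'I_3}) (Q : {set 'I_n}) (K T : nat).

Local Notation half := (2^-1 : R).

Definition hit T f Q : bool :=
  [forall x in Q, f x != 0 :> nat] && (\sum_(x in Q) f x == T)%N.

Lemma sum_geometric_tail z :
  \sum_(i < z.+1) half ^+ minn i.+1 z = 1.
Proof.
rewrite big_ord_recr /= (minn_idPr (leqnSn z)).
rewrite (eq_bigr (fun i : 'I_z => half ^+ i.+1)) => [|i _]; last first.
  by rewrite (minn_idPl (ltn_ord i)).
elim: z => [|z IHz]; first by rewrite big_ord0 add0r expr0.
by rewrite big_ord_recr /= -addrA half_expS.
Qed.

(** For [z] elements of colour 0 the exponents are 1, 2, ..., [z - 1], [z - 1]: the last one is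
    repeated so that the total is exactly one unit. *)
Definition tail_weight f (x : 'I_n) : R :=
  let Z := enum [pred y | f y == 0 :> nat] in
  if f x == 0 :> nat then half ^+ minn (index x Z).+1 (size Z).-1 else 0.

Lemma tail_weight_ge0 f x : 0 <= tail_weight f x.
Proof. by rewrite /tail_weight; case: ifP => // _; rewrite ltW ?half_exp_gt0. Qed.

Lemma sum_tail_weight f :
  (exists x, f x = 0 :> nat) -> \sum_x tail_weight f x = 1.
Proof.
move=> [x0 fx0]; rewrite /tail_weight; set Z := enum _.
have x0Z : x0 \in Z by rewrite mem_enum inE fx0.
rewrite -big_mkcond (eq_bigl [in [pred y | f y == 0 :> nat]]) // -big_enum -/Z.
rewrite (big_nth x0) big_mkord.
case sZ : (size Z) => [|z]; first by move: x0Z; rewrite (size0nil sZ).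
rewrite -[RHS](sum_geometric_tail z); apply: eq_bigr => i _.
by rewrite index_uniq ?sZ ?enum_uniq.
Qed.

Definition colour_depth K f (x : 'I_n) : nat :=
  let Z := enum [pred y | f y == 0 :> nat] in
  match nat_of_ord (f x) with
  | 0 => K.+1 + minn (index x Z).+1 (size Z).-1
  | 1 => K.+1
  | _ => K
  end.

Lemma colour_depthE K f x :
  half ^+ colour_depth K f x = half ^+ K.+1 * ((f x)%:R + tail_weight f x).
Proof.
rewrite /colour_depth /tail_weight.
case: (f x) => [[|[|[|//]]] ?] /=; first by rewrite exprD add0r.
  by rewrite addr0 mulr1.
by rewrite addr0 exprS; field.
Qed.

(** [2 ^ K] is an integer plus a tail mass between 0 and 1, so that mass is 0 or 1, and [Q] or its
    complement avoids colour 0. *)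
Lemma optimal_hit (F : {set {set 'I_n}}) K f :
  optimal R F -> (1 < n)%N -> (exists x, f x = 0 :> nat) ->
  (\sum_x f x).+1 = (2 ^ K.+1)%N ->
  exists2 Q, Q \in F & hit (2 ^ K) f Q || hit (2 ^ K) f (~: Q).
Proof.
move=> optF n1 f0 sumf.
have hK : half ^+ K.+1 * (2 ^ K.+1)%:R = 1.
  by rewrite natrX -exprMn mulVf ?expr1n.
have [|Q QF sumQ] := optimal_split optF n1 (l := colour_depth K f).
  under eq_bigr do rewrite colour_depthE.
  by rewrite -big_distrr /= big_split /= -natr_sum sum_tail_weight // natr1 sumf.
exists Q => //; set m := (\sum_(x in Q) f x)%N.
set t := \sum_(x in Q) tail_weight f x.
have mt : m%:R + t = (2 ^ K)%:R.
  move: sumQ; under eq_bigr do rewrite colour_depthE.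
  rewrite -big_distrr /= big_split /= -natr_sum -/m -/t => sumQ.
  have h0 := half_exp_gt0 R K.+1.
  apply: (mulfI (lt0r_neq0 h0)); rewrite sumQ.
  by move: hK; rewrite expnS natrM; lra.
have t0 : 0 <= t by apply: sumr_ge0 => x _; apply: tail_weight_ge0.
have sumtC : t + \sum_(x in ~: Q) tail_weight f x = 1.
  rewrite -[RHS](sum_tail_weight f0) [RHS](bigID [in Q]) /=; congr (_ + _).
  by apply: eq_bigl => x; rewrite inE.
have tC0 : 0 <= \sum_(x in ~: Q) tail_weight f x.
  by apply: sumr_ge0 => x _; apply: tail_weight_ge0.
have no_tail (A : {set 'I_n}) : \sum_(x in A) tail_weight f x = 0 ->
    [forall x in A, f x != 0 :> nat].
  move=> A0; apply/forall_inP => x xA.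
  have := psumr_eq0P (fun i _ => tail_weight_ge0 f i) A0 xA.
  rewrite /tail_weight; case: ifP => // _ /eqP.
  by rewrite gt_eqF ?half_exp_gt0.
have /orP[/eqP mK|/eqP mK] : (m == 2 ^ K)%N || (m.+1 == 2 ^ K)%N.
  have : (m <= 2 ^ K)%N by rewrite -(ler_nat R) -mt lerDl.
  have : (2 ^ K <= m.+1)%N.
    by rewrite -(ler_nat R) -mt -natr1 lerD2l -sumtC lerDl.
  by lia.
- apply/orP; left; rewrite /hit -/m mK eqxx andbT; apply: no_tail.
  by apply: (addrI m%:R); rewrite mt mK addr0.
- apply/orP; right; rewrite /hit no_tail /=.
    (* Here [Q] holds the whole tail and colours adding up to [2 ^ K - 1]; all colours add up to
       [2 ^ K.+1 - 1], which leaves [2 ^ K] for the complement. *)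
    have : (\sum_(x in ~: Q) f x + m = \sum_x f x)%N.
      rewrite [RHS](bigID [in Q]) /= addnC; congr (_ + _)%N.
      by apply: eq_bigl => x; rewrite inE.
    move: sumf; rewrite expnS => sumf sumC; apply/eqP.
    by rewrite -sumC in sumf; set s := (\sum_(x in ~: Q) _)%N in sumf *; lia.
  move: mt sumtC; rewrite -mK -natr1 => /addrI->.
  by rewrite -[RHS]addr0 => /addrI.
Qed.

(** Expanding the product over [x] of the sums of [W x] over the colours gives the total weight of
    all colourings, which is thus at most 1. *)
Lemma hit_count (g : 'I_3 -> R) (u G : R) T Q :
  (forall k, 0 < g k) -> 1 <= u ->
  \sum_(k : 'I_3 | k != 0 :> nat) g k * u ^+ k <= 1 -> \sum_(k : 'I_3) g k * u ^- k <= 1 ->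
  #|[set f : {ffun 'I_n -> 'I_3} |
      [&& \prod_x g (f x) == G, (\sum_x f x).+1 == T.*2 & hit T f Q]]|%:R * G
  <= 1.
Proof.
move=> g0 u1 inQ outQ.
have u0 : 0 < u by apply: lt_le_trans u1.
pose W x (k : 'I_3) : R :=
  if x \in Q then (if k != 0 :> nat then g k * u ^+ k else 0) else g k * u ^- k.
have W0 x k : 0 <= W x k.
  rewrite /W; case: ifP => _; last by rewrite mulr_ge0 ?invr_ge0 ?exprn_ge0 // ltW.
  by case: ifP => // _; rewrite mulr_ge0 ?exprn_ge0 // ltW.
have tot : \sum_(f : {ffun 'I_n -> 'I_3}) \prod_x W x (f x) <= 1.
  rewrite -bigA_distr_bigA; apply: prodr_ile1 => x _; rewrite sumr_ge0 //=.
  by rewrite /W; case: (x \in Q); rewrite // -big_mkcond.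
apply: le_trans tot; rewrite (bigID (fun f =>
  [&& \prod_x g (f x) == G, (\sum_x f x).+1 == T.*2 & hit T f Q])) /=.
rewrite -[leLHS]addr0 lerD //; last by apply: sumr_ge0 => f _; apply: prodr_ge0.
rewrite mulr_natl -sumr_const; rewrite (eq_bigl _ _ (in_set _)).
apply: ler_sum => f /and3P[/eqP gG /eqP sumf /andP[/forall_inP f0 /eqP sumQ]].
(* There are [T] units inside [Q] and only [T - 1] outside, so one factor [u] survives; it is at
   least 1. *)
have -> : \prod_x W x (f x) = G * u.
  rewrite (eq_bigr (fun x => g (f x) * (if x \in Q then u ^+ f x else u ^- f x))).
    rewrite big_split gG /=; congr (_ * _).
    rewrite (bigID [in Q]) /=.
    rewrite (eq_bigr (fun x => u ^+ f x)) => [|x ->//].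
    rewrite [X in _ * X](eq_bigr (fun x => (u ^+ f x)^-1)) => [|x /negbTE->//].
    rewrite prodfV !prodrXr.
    have : (\sum_(x in Q) f x + \sum_(x | x \notin Q) f x = \sum_x f x)%N.
      by rewrite [RHS](bigID [in Q]).
    rewrite sumQ => sumC.
    have -> : T = (\sum_(x | x \notin Q) f x).+1.
      by move: sumf; rewrite -sumC; set s := (\sum_(x | _) _)%N; lia.
    by rewrite exprS mulfK // expf_neq0 // gt_eqF.
  move=> x _; rewrite /W; case: ifP => xQ //.
  by rewrite f0.
by rewrite ler_peMr // -gG prodr_ge0 // => x _; rewrite ltW.
Qed.

Definition colouring (AB : {set 'I_n} * {set 'I_n}) : {ffun 'I_n -> 'I_3} :=
  [ffun x => if x \in AB.1 then inord 2 else if x \in AB.2 then inord 1 else inord 0].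

Lemma colouringE AB x : nat_of_ord (colouring AB x) =
  if x \in AB.1 then 2%N else if x \in AB.2 then 1%N else 0%N.
Proof. by rewrite ffunE; case: ifP => _; [|case: ifP => _]; rewrite inordK. Qed.

Lemma card_colourings (g : 'I_3 -> R) (a b : nat) : (a + b < n)%N ->
  ('C(n, a) * 'C(n - a, b) <=
   #|[set f : {ffun 'I_n -> 'I_3} |
      [&& (\prod_x g (f x) ==
            g (inord 2) ^+ a * g (inord 1) ^+ b * g (inord 0) ^+ (n - a - b))%R,
          \sum_x f x == a.*2 + b & [exists x, f x == 0 :> nat]]]|)%N.
Proof.
move=> abn.
pose P := [set AB : {set 'I_n} * {set 'I_n} |
  (#|AB.1| == a) && ((AB.2 \subset ~: AB.1) && (#|AB.2| == b))].
have <- : #|P| = ('C(n, a) * 'C(n - a, b))%N.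
  rewrite -sum1_card (eq_bigl _ _ (in_set _)).
  rewrite -(pair_big_dep (fun A : {set 'I_n} => #|A| == a)
    (fun A B : {set 'I_n} => (B \subset ~: A) && (#|B| == b)) (fun _ _ => 1%N)) /=.
  rewrite (eq_bigr (fun=> 'C(n - a, b))) => [|A /eqP cA]; last first.
    by rewrite sum1dep_card cards_draws cardsCs setCK card_ord cA.
  by rewrite sum_nat_const -[in 'C(n, a)](card_ord n) -card_draws cardsE.
have colP AB : AB \in P -> forall x, x \in AB.2 -> x \in AB.1 = false.
  rewrite inE => /and3P[_ /subsetP BA _] x /BA.
  by rewrite inE => /negbTE.
rewrite -(card_in_imset (f := colouring)); last first.
  move=> [A B] [A' B'] /colP /= dAB /colP /= dAB' /ffunP eqc; congr (_, _); apply/setP => x.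
    have := congr1 val (eqc x); rewrite /= !colouringE /=.
    by do 4!case: ifP => //.
  have := congr1 val (eqc x); rewrite /= !colouringE /=.
  have := dAB x; have := dAB' x.
  by case: (x \in A); case: (x \in A'); case: (x \in B); case: (x \in B');
    do ?[move=> /(_ isT) // | move=> _].
apply/subset_leq_card/subsetP => _ /imsetP[AB ABP ->].
have cAB := colP _ ABP; move: ABP; rewrite !inE => /and3P[/eqP cA sBA /eqP cB].
have cC : #|~: (AB.1 :|: AB.2)| = (n - a - b)%N.
  rewrite cardsCs setCK card_ord cardsU cA cB.
  rewrite (_ : AB.1 :&: AB.2 = set0) ?cards0; first by lia.
  apply/setP => x; rewrite !inE; apply/negP => /andP[x1 x2].
  by rewrite cAB in x1.
(* Stated for any commutative monoid, to serve both the sum of the colours and the product of the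
   weights. *)
have split_big (S : Type) (idx : S) (op : Monoid.com_law idx) (F : nat -> S) :
    \big[op/idx]_x F (colouring AB x) =
    op (\big[op/idx]_(x in AB.1) F 2%N)
     (op (\big[op/idx]_(x in AB.2) F 1%N) (\big[op/idx]_(x in ~: (AB.1 :|: AB.2)) F 0%N)).
  rewrite [LHS](bigID [in AB.1]) /=; congr (op _ _).
    by apply: eq_bigr => x x1; rewrite colouringE x1.
  rewrite [LHS](bigID [in AB.2]) /=; congr (op _ _).
    apply: eq_big => x; first by case: (boolP (x \in AB.2)) => [/cAB->|]; rewrite ?andbF.
    by case/andP => /negbTE x1 x2; rewrite colouringE x1 x2.
  apply: eq_big => x; first by rewrite !inE negb_or.
  by case/andP => /negbTE x1 /negbTE x2; rewrite colouringE x1 x2.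
rewrite (split_big _ _ _ id) !sum_nat_const cA cB cC muln0 /= addn0 muln1 muln2 eqxx /=.
apply/andP; split; last first.
  have /card_gt0P[x] : (0 < #|~: (AB.1 :|: AB.2)|)%N by rewrite cC; lia.
  rewrite !inE negb_or => /andP[/negbTE x1 /negbTE x2].
  by apply/existsP; exists x; rewrite colouringE x1 x2.
rewrite (eq_bigr (fun x => g (inord (colouring AB x)))) => [|x _]; last by rewrite inord_val.
rewrite (split_big _ _ _ (fun k => g (inord k))) !prodr_const /= cA cB cC.
by rewrite mulrA.
Qed.

Lemma optimal_card (F : {set {set 'I_n}}) K (a b : nat) (g : 'I_3 -> R) (u : R) :
  optimal R F -> (1 < n)%N -> (a + b < n)%N -> (a.*2 + b).+1 = (2 ^ K.+1)%N ->
  (forall k, 0 < g k) -> 1 <= u ->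
  \sum_(k : 'I_3 | k != 0 :> nat) g k * u ^+ k <= 1 ->
  \sum_(k : 'I_3) g k * u ^- k <= 1 ->
  ('C(n, a) * 'C(n - a, b))%:R
    * (g (inord 2) ^+ a * g (inord 1) ^+ b * g (inord 0) ^+ (n - a - b))
  <= #|F|%:R *+ 2.
Proof.
move=> optF n1 abn abK g0 u1 inQ outQ; set G := _ * _ * _.
have G0 : 0 < G by rewrite !mulr_gt0 ?exprn_gt0.
have := card_colourings g abn; rewrite -/G -(ler_nat R); set S := [set _ | _] => CS.
apply: (le_trans (ler_wpM2r (ltW G0) CS)).
pose H Q := [set f : {ffun 'I_n -> 'I_3} |
  [&& \prod_x g (f x) == G, (\sum_x f x).+1 == (2 ^ K).*2 & hit (2 ^ K) f Q]].
(* Every colouring is hit by a query of [F] or by its complement: a union bound over [2 * #|F|]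
   sets. *)
have SH : S \subset \bigcup_(Q in F) (H Q :|: H (~: Q)).
  apply/subsetP => f; rewrite inE => /and3P[fG /eqP sumf /existsP[x /eqP fx]].
  have sumf1 : (\sum_x f x).+1 = (2 ^ K.+1)%N by rewrite sumf.
  have [|Q QF Qf] := optimal_hit optF n1 _ sumf1; first by exists x.
  apply/bigcupP; exists Q => //; rewrite !inE fG sumf1 expnS mul2n eqxx /=.
  exact: Qf.
have HG Q : #|H Q|%:R * G <= 1 by apply: hit_count outQ.
apply: (@le_trans _ _ (\sum_(Q in F) (#|H Q|%:R * G + #|H (~: Q)|%:R * G))).
  under eq_bigr do rewrite -mulrDl -natrD.
  rewrite -big_distrl -natr_sum /=; apply: ler_wpM2r; first exact: ltW.
  rewrite ler_nat; apply: leq_trans (subset_leq_card SH) _.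
  elim/big_ind2: _ => [|A i B j Ai Bj|Q _]; rewrite ?cards0 // cardsU.
    by rewrite (leq_trans (leq_subr _ _)) ?leq_add.
  exact: leq_subr.
rewrite -mulr_natl mulrC mulr_natr -sumr_const -sumrMnl; apply: ler_sum => Q _.
by rewrite mulr2n lerD.
Qed.

End Colourings.

(** * Certificates *)

Section BinaryCast.
Variable R : realFieldType.
Implicit Types x y : N.

Definition ncast x : R := (N.to_nat x)%:R.

Lemma ncastD x y : ncast (x + y)%num = ncast x + ncast y.
Proof. by rewrite /ncast N2Nat.inj_add -natrD. Qed.

Lemma ncastM x y : ncast (x * y)%num = ncast x * ncast y.
Proof. by rewrite /ncast N2Nat.inj_mul -natrM. Qed.

Lemma ncastX x (m : nat) : ncast (x ^ N.of_nat m)%num = ncast x ^+ m.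
Proof.
elim: m => [|m IHm]; first by rewrite expr0.
by rewrite Nat2N.inj_succ N.pow_succ_r' ncastM IHm exprS.
Qed.

Lemma ncast_of_nat (m : nat) : ncast (N.of_nat m) = m%:R.
Proof. by rewrite /ncast Nat2N.id. Qed.

Lemma ncast_le x y : (x <=? y)%num -> ncast x <= ncast y.
Proof. by move=> /N.leb_le xy; rewrite /ncast ler_nat; lia. Qed.

End BinaryCast.

(* With [N = a + b + c] and [g = G / 10^6], the claim is
   [(N g2 / (1.236 a))^a (N g1 / (1.236 b))^b (N g0 / (1.236 c))^c >= 1].  The exact
   integers would have thousands of bits, so the product is evaluated in fixed point,
   with 32 fractional bits and every operation rounded down. *)
Definition fixed_mul (y t : N) : N := ((t * y) / 2 ^ 32)%num.

Definition fixed_ratio (n : nat) (G : N) (d : nat) : N :=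
  (N.of_nat n * G * 250 * 2 ^ 32 / (309 * 10 ^ 6 * N.of_nat d))%num.

Definition block_ok (G2 G1 G0 : N) (a b c : nat) : bool :=
  let pow G d := iter d (fixed_mul (fixed_ratio (a + b + c)%N G d)) in
  [&& (0 < a)%N, (0 < b)%N, (0 < c)%N &
      (2 ^ 32 <=? pow G0 c (pow G1 b (pow G2 a (2 ^ 32))))%num].

(* The constraints of [hit_count], for [u = p / 100] and [g = G / 10^6]. *)
Definition weights_ok (G2 G1 G0 p : N) : bool :=
  [&& (1000 <=? G2)%num, (1000 <=? G1)%num, (1000 <=? G0)%num, (100 <=? p)%num,
      (G2 * p * p + G1 * p * 100 <=? 10 ^ 6 * 100 * 100)%num &
      (G2 * 100 * 100 + G1 * p * 100 + G0 * p * p <=? 10 ^ 6 * p * p)%num].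

Section Weights.
Variable R : realFieldType.

Definition weight (G2 G1 G0 : N) (k : 'I_3) : R :=
  ncast R (match nat_of_ord k with 0 => G0 | 1 => G1 | _ => G2 end) / 10 ^+ 6.

Local Notation rho := (1236 / 1000 : R).

Lemma sum_ord3 (V : nmodType) (F : 'I_3 -> V) :
  \sum_k F k = F (inord 2) + F (inord 1) + F (inord 0).
Proof.
rewrite !big_ord_recl big_ord0 addr0 [RHS]addrC [X in _ = _ + X]addrC.
by congr (F _ + (F _ + F _)); apply: val_inj; rewrite /= inordK.
Qed.

(** The inequalities are cleared of denominators. The bound 1/1000 later pays for the elements left
    outside the blocks. *)
Lemma weights_okP G2 G1 G0 p : weights_ok G2 G1 G0 p ->
  let g := weight G2 G1 G0 in let u := ncast R p / 100 in
  [/\ forall k, 1 / 1000 <= g k, 1 <= u,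
      \sum_(k : 'I_3 | k != 0 :> nat) g k * u ^+ k <= 1
    & \sum_(k : 'I_3) g k * u ^- k <= 1].
Proof.
case/and5P => /(ncast_le R) h2 /(ncast_le R) h1 /(ncast_le R) h0 /(ncast_le R) hp.
case/andP => /(ncast_le R) in1 /(ncast_le R) in2 g u.
have c100 : ncast R 100 = 100 by [].
have c1000 : ncast R 1000 = 1000 by [].
have c10 : ncast R (10 ^ 6)%num = 10 ^+ 6 by rewrite -(ncastX R 10 6).
rewrite !c100 !c1000 in h2 h1 h0 hp.
rewrite !(ncastD, ncastM) c100 c10 in in1.
rewrite !(ncastD, ncastM) c100 c10 in in2.
have p0 : 0 < ncast R p by apply: lt_le_trans hp; rewrite ltr0n.
rewrite big_mkcond !sum_ord3 /= !inordK //= addr0 /g /weight !inordK //=.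
split.
- clear in1 in2; move=> k; rewrite /weight ler_pdivlMr ?exprn_gt0 //.
  by case: (nat_of_ord k) => [|[|m]] /=; lra.
- by clear in1 in2; rewrite /u; lra.
- clear in2; rewrite /u expr1; move: in1; set P := ncast R p; lra.
- rewrite /u !expr0 expr1 invr1 mulr1.
  rewrite -(ler_pM2r (x := ncast R p ^+ 2 * 10 ^+ 6)); last by rewrite mulr_gt0 ?exprn_gt0.
  rewrite [leLHS](_ : _ =
      ncast R G2 * 100 * 100 + ncast R G1 * ncast R p * 100 + ncast R G0 * ncast R p * ncast R p);
    last by field; rewrite gt_eqF.
  by apply: (le_trans in2); rewrite -subr_ge0 [leRHS](_ : _ = 0) //; ring.
Qed.

Local Notation scale := (ncast R (2 ^ 32)%num).

Lemma scale_gt0 : 0 < scale.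
Proof. by rewrite (ncastX R 2 32) exprn_gt0 // ltr0n. Qed.

(** Every multiplication rounds down, so the computed value stays below the exact one. *)
Lemma fixed_pow_le y t m :
  ncast R (iter m (fixed_mul y) t) <= ncast R t * (ncast R y / scale) ^+ m.
Proof.
elim: m => [|m IHm]; first by rewrite expr0 mulr1.
have y0 : 0 <= ncast R y / scale by rewrite divr_ge0 ?ler0n.
apply: (@le_trans _ _ (ncast R (iter m (fixed_mul y) t) * (ncast R y / scale))).
  rewrite mulrA ler_pdivlMr ?scale_gt0 // -!ncastM.
  apply/ncast_le/N.leb_le; rewrite N.mul_comm; exact: N.mul_div_le.
by rewrite exprSr [leRHS]mulrA; apply: ler_wpM2r.
Qed.

Lemma fixed_pow3_le y2 y1 y0 t a b c :
  ncast R (iter c (fixed_mul y0) (iter b (fixed_mul y1) (iter a (fixed_mul y2) t)))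
  <= ncast R t *
     ((ncast R y2 / scale) ^+ a * (ncast R y1 / scale) ^+ b * (ncast R y0 / scale) ^+ c).
Proof.
have r0 y m : 0 <= (ncast R y / scale) ^+ m.
  by apply: exprn_ge0; rewrite divr_ge0 ?ler0n.
rewrite [ncast R t * _]mulrA; apply: le_trans (fixed_pow_le _ _ _) _.
apply: ler_wpM2r; first exact: r0.
rewrite mulrA; apply: le_trans (fixed_pow_le _ _ _) _.
apply: ler_wpM2r; first exact: r0.
exact: fixed_pow_le.
Qed.

Lemma fixed_ratio_le n G d : (0 < d)%N ->
  ncast R (fixed_ratio n G d) / scale <= n%:R * (ncast R G / 10 ^+ 6) / (rho * d%:R).
Proof.
move=> d0; have c10 : ncast R (10 ^ 6)%num = 10 ^+ 6 by rewrite -(ncastX R 10 6).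
have c250 : ncast R 250 = 250 by [].
have c309 : ncast R 309 = 309 by [].
have : ncast R (309 * 10 ^ 6 * N.of_nat d)%num * ncast R (fixed_ratio n G d)
    <= ncast R (N.of_nat n * G * 250 * 2 ^ 32)%num.
  by rewrite -ncastM; apply/ncast_le/N.leb_le; apply: N.mul_div_le; lia.
rewrite !ncastM !ncast_of_nat c10 c250 c309.
have x0 : 0 < 10 ^+ 6 :> R by rewrite exprn_gt0 ?ltr0n.
have dR : 0 < d%:R :> R by rewrite ltr0n.
have := scale_gt0; move: scale (ncast R (fixed_ratio n G d)) (ncast R G) x0 dR.
move: (10 ^+ 6 : R) (d%:R : R) (n%:R : R) => x t m s y g x0 t0 s0 le.
rewrite ler_pdivrMr // [leRHS](_ : _ = m * g * 250 * s / (309 * x * t)); last first.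
  by field; rewrite !gt_eqF.
rewrite ler_pdivlMr; first by rewrite mulrC.
by rewrite !mulr_gt0 ?ltr0n.
Qed.

Lemma block_okP G2 G1 G0 a b c : block_ok G2 G1 G0 a b c ->
  let g := weight G2 G1 G0 in
  rho ^+ (a + b + c) * (a ^ a * b ^ b * c ^ c)%:R <=
  ((a + b + c) ^ (a + b + c))%:R
    * (g (inord 2) ^+ a * g (inord 1) ^+ b * g (inord 0) ^+ c).
Proof.
case/and4P => a0 b0 c0 /(ncast_le R) le; set n := (a + b + c)%N.
pose r G d := ncast R (fixed_ratio n G d) / scale.
pose z G d := n%:R * (ncast R G / 10 ^+ 6) / (rho * d%:R).
have rho0 : 0 < rho by rewrite divr_gt0 ?ltr0n.
have r0 G d : 0 <= r G d by rewrite divr_ge0 ?ler0n.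
have rz G d : (0 < d)%N -> r G d ^+ d <= z G d ^+ d.
  move=> d0; have := fixed_ratio_le n G d0; rewrite -/(r G d) -/(z G d) => rz.
  by apply: lerXn2r; [exact: r0 | exact: (le_trans (r0 G d) rz) | exact: rz].
(* [z] gives the exact factors and [r] their rounded values, whose product is at least 1 by the
   check. *)
have prod1 : 1 <= z G2 a ^+ a * z G1 b ^+ b * z G0 c ^+ c.
  apply: (@le_trans _ _ (r G2 a ^+ a * r G1 b ^+ b * r G0 c ^+ c)); last first.
    by do 2?[apply: ler_pM; rewrite ?mulr_ge0 ?exprn_ge0 // ?rz //].
  rewrite -(ler_pM2l scale_gt0) mulr1; apply: le_trans le _.
  exact: fixed_pow3_le.
have t0 d : (0 < d)%N -> 0 < d%:R :> R by rewrite ltr0n.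
have D0 : 0 < rho ^+ n * (a ^ a * b ^ b * c ^ c)%:R.
  by rewrite mulr_gt0 ?exprn_gt0 // ltr0n !muln_gt0 !expn_gt0 a0 b0 c0.
rewrite -(ler_pM2l D0) mulr1 in prod1; apply: (le_trans prod1).
rewrite le_eqVlt; apply/orP; left; apply/eqP.
have zE G d : (0 < d)%N ->
    z G d ^+ d * (rho ^+ d * d%:R ^+ d) = n%:R ^+ d * (ncast R G / 10 ^+ 6) ^+ d.
  move=> /t0 d0; have rd0 : rho * d%:R != 0.
    by apply: mulf_neq0; apply: lt0r_neq0.
  by rewrite -!exprMn (divfK rd0).
rewrite [LHS](_ : _ = z G2 a ^+ a * (rho ^+ a * a%:R ^+ a) *
  (z G1 b ^+ b * (rho ^+ b * b%:R ^+ b)) * (z G0 c ^+ c * (rho ^+ c * c%:R ^+ c))).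
  have nE : n%:R ^+ n = n%:R ^+ a * n%:R ^+ b * n%:R ^+ c :> R by rewrite -!exprD.
  rewrite !zE // /weight !inordK //= natrX nE; set s2 := _ ^+ a; set s1 := _ ^+ b.
  set s0 := _ ^+ c; set g2 := _ ^+ a; set g1 := _ ^+ b; set g0 := _ ^+ c.
  by ring.
rewrite !natrM !natrX /n !exprD.
move: (rho ^+ a) (rho ^+ b) (rho ^+ c) (z G2 a ^+ a) (z G1 b ^+ b) (z G0 c ^+ c).
by move=> p2 p1 p0 s2 s1 s0; ring.
Qed.

End Weights.

(** * Gluing blocks and covering an octave *)

Section Assembly.
Variable R : realType.
Local Notation rho := (1236 / 1000 : R).

Lemma rho_gt0 : 0 < rho.
Proof. lra. Qed.

Lemma rho_exp_ge0 k : 0 <= rho ^+ k.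
Proof. exact: exprn_ge0 (ltW rho_gt0). Qed.

Lemma weight_ge0 G2 G1 G0 k : 0 <= weight R G2 G1 G0 k.
Proof. exact: divr_ge0 (ler0n _ _) (exprn_ge0 _ (ler0n _ _)). Qed.

Lemma block_lower G2 G1 G0 a b c N m (g := weight R G2 G1 G0) :
  block_ok G2 G1 G0 a b c -> (a + b + c = N)%N ->
  rho ^+ (m * N) <= (m * N).+1%:R ^+ 2 *
    ('C(m * N, m * a) * 'C(m * (N - a), m * b))%:R *
    (g (inord 2) ^+ a * g (inord 1) ^+ b * g (inord 0) ^+ c) ^+ m.
Proof.
move=> /(block_okP R) ok NE; move: ok; cbv zeta; rewrite -/g NE; set X := ('C(_, _) * _)%N.
set D := (a ^ a * b ^ b * c ^ c)%N; set w := (_ * _ * _ : R) => ok.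
have mult : (N ^ N)%:R ^+ m <= (m * N).+1%:R ^+ 2 * X%:R * D%:R ^+ m :> R.
  by rewrite -!natrX -!natrM ler_nat; exact: multinomial_block NE.
have D0 : 0 < D%:R :> R.
  have self_exp x : (0 < x ^ x)%N by rewrite expn_gt0; case: x.
  by rewrite ltr0n /D !muln_gt0 !self_exp.
have rD : 0 <= rho ^+ N * D%:R by exact: mulr_ge0 (rho_exp_ge0 _) (ltW D0).
have h : (rho ^+ N * D%:R) ^+ m <= ((N ^ N)%:R * w) ^+ m.
  by apply: lerXn2r; [exact: rD | exact: (le_trans rD ok) | exact: ok].
have w0 : 0 <= w ^+ m.
  by apply: exprn_ge0; do !apply: mulr_ge0; apply: exprn_ge0; apply: weight_ge0.
rewrite -(ler_pM2r (exprn_gt0 m D0)) [(m * N)%N in leLHS]mulnC exprM -exprMn.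
apply: (le_trans h); rewrite exprMn.
apply: le_trans (ler_wpM2r w0 mult) _.
by rewrite le_eqVlt; apply/orP; left; apply/eqP; rewrite mulrAC.
Qed.

(** Counts for [m] blocks of one type, [m'] of another and [r] extra elements, [s] of them of colour
    1 and the others of colour 0. *)
Lemma blocks_arith N n m m' r s a b c a' b' c' :
  (a + b + c = N)%N -> (a' + b' + c' = N)%N ->
  (n = m * N + m' * N + r)%N -> (s < r)%N ->
  let A := (m * a + m' * a')%N in let B := (m * b + m' * b' + s)%N in
  [/\ (A + B < n)%N,
      (m * (a.*2 + b) + m' * (a'.*2 + b') + s = A.*2 + B)%N,
      (n - A = m * (N - a) + m' * (N - a') + r)%N
    & (n - A - B = m * c + m' * c' + (r - s))%N].
Proof.
move=> abc abc' -> sr A B.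
have mN : (m * N = m * a + m * b + m * c)%N by rewrite -abc !mulnDr.
have mN' : (m' * N = m' * a' + m' * b' + m' * c')%N by rewrite -abc' !mulnDr.
have mNa : (m * (N - a) = m * b + m * c)%N by rewrite -mulnDr; congr muln; lia.
have mNa' : (m' * (N - a') = m' * b' + m' * c')%N.
  by rewrite -mulnDr; congr muln; lia.
rewrite /A /B mNa mNa' mN mN'; split; try lia.
Qed.

(** Both block types share [g] and [u], so [optimal_card] applies to the mixture. Superadditivity of
    binomials reduces it to the two block bounds, and each extra element costs at most a factor
    1000. *)
Lemma interpolated_bound n (F : {set {set 'I_n}}) K m m' r s
    G2 G1 G0 p a b c a' b' c' N :
  optimal R F -> (1 < n)%N -> weights_ok G2 G1 G0 p ->
  block_ok G2 G1 G0 a b c -> block_ok G2 G1 G0 a' b' c' ->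
  (a + b + c = N)%N -> (a' + b' + c' = N)%N ->
  (n = m * N + m' * N + r)%N -> (s < r)%N ->
  (m * (a.*2 + b) + m' * (a'.*2 + b') + s).+1 = (2 ^ K.+1)%N ->
  rho ^+ (m * N + m' * N) <= 2 * n.+1%:R ^+ 4 * 1000 ^+ r * #|F|%:R.
Proof.
move=> optF n1 wok bok bok' abc abc' nE sr KE.
have [g_ge u1 inQ outQ] := weights_okP R wok.
have lo := block_lower m bok abc; have lo' := block_lower m' bok' abc'.
set g := weight R G2 G1 G0 in g_ge inQ outQ lo lo'; clearbody g.
have g0 k : 0 < g k by apply: lt_le_trans (g_ge k); lra.
pose A := (m * a + m' * a')%N; pose B := (m * b + m' * b' + s)%N.
have [AB AK nA nAB] := blocks_arith abc abc' nE sr.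
rewrite -/A -/B in AB AK nA nAB; rewrite {}AK in KE.
have := optimal_card optF n1 AB KE g0 u1 inQ outQ.
rewrite nAB nA.
set X := ('C(m * N, m * a) * _)%N in lo; set X' := ('C(m' * N, _) * _)%N in lo'.
(* The extra elements contribute ['C(r, 0)] and ['C(r, s)], both at least 1. *)
have XX : (X * X' <= 'C(n, A) * 'C(m * (N - a) + m' * (N - a') + r, B))%N.
  rewrite /X /X' mulnACA leq_mul //.
    apply: leq_trans (bin_super _ _ _ _) _; rewrite -/A.
    by have := bin_super (m * N + m' * N) A r 0; rewrite bin0 muln1 addn0 -nE.
  apply: leq_trans (bin_super _ _ _ _) _.
  apply: leq_trans (bin_super _ _ r s); rewrite leq_pmulr // bin_gt0.
  exact: ltnW.
move=> le2F; pose w : R := g (inord 2) ^+ a * g (inord 1) ^+ b * g (inord 0) ^+ c.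
pose w' : R := g (inord 2) ^+ a' * g (inord 1) ^+ b' * g (inord 0) ^+ c'.
rewrite -/w in lo; rewrite -/w' in lo'.
pose Y : R := g (inord 2) ^+ A * g (inord 1) ^+ B
  * g (inord 0) ^+ (m * c + m' * c' + (r - s)).
rewrite -/Y in le2F.
have YE : Y = w ^+ m * w' ^+ m' * (g (inord 1) ^+ s * g (inord 0) ^+ (r - s)).
  rewrite /Y /A /B /w /w' !exprMn !exprD !exprM ![_ ^+ m ^+ _]exprAC.
  rewrite ![_ ^+ m' ^+ _]exprAC.
  set x := g _ ^+ _ ^+ m; set x' := g _ ^+ _ ^+ m'; set y := g _ ^+ _ ^+ m.
  set y' := g _ ^+ _ ^+ m'; set z := g _ ^+ _ ^+ m; set z' := g _ ^+ _ ^+ m'.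
  by ring.
have gr : 1 <= 1000 ^+ r * (g (inord 1) ^+ s * g (inord 0) ^+ (r - s)).
  rewrite -{1}(subnKC (ltnW sr)) exprD mulrACA -!exprMn.
  rewrite mulr_ege1 // exprn_ege1 //.
    by move: (g_ge (inord 1)); clear; lra.
  by move: (g_ge (inord 0)); clear; lra.
have w0 : 0 <= w by rewrite !mulr_ge0 ?exprn_ge0 // ltW.
have w0' : 0 <= w' by rewrite !mulr_ge0 ?exprn_ge0 // ltW.
have Y0 : 0 <= Y by rewrite !mulr_ge0 ?exprn_ge0 // ltW.
have nn : (m * N).+1%:R ^+ 2 * (m' * N).+1%:R ^+ 2 <= n.+1%:R ^+ 4 :> R.
  have mn : (m * N <= n)%N by rewrite nE -addnA leq_addr.
  have mn' : (m' * N <= n)%N by rewrite nE addnAC leq_addl.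
  rewrite (exprD _ 2 2); apply: ler_pM; rewrite ?exprn_ge0 //.
    by apply: lerXn2r; rewrite ?nnegrE ?ler0n // ler_nat ltnS.
  by apply: lerXn2r; rewrite ?nnegrE ?ler0n // ler_nat ltnS.
rewrite exprD.
have lo2 : rho ^+ (m * N) * rho ^+ (m' * N) <=
    n.+1%:R ^+ 4 * (X * X')%:R * (w ^+ m * w' ^+ m').
  apply: (le_trans (ler_pM (rho_exp_ge0 _) (rho_exp_ge0 _) lo lo')).
  move: nn; set s1 := _.+1%:R ^+ 2; set s2 := _.+1%:R ^+ 2 => nn.
  rewrite [leLHS](_ : _ = s1 * s2 * ((X * X')%:R * (w ^+ m * w' ^+ m'))).
    rewrite -[leRHS]mulrA; apply: ler_wpM2r nn.
    by apply: mulr_ge0 (ler0n _ _) _; apply: mulr_ge0; apply: exprn_ge0.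
  rewrite natrM; move: (X%:R : R) (X'%:R : R) (w ^+ m) (w' ^+ m') => t t' v v'.
  by ring.
apply: (le_trans lo2).
apply: (@le_trans _ _ (n.+1%:R ^+ 4 * 1000 ^+ r * ((X * X')%:R * Y))).
  rewrite YE; set z := g (inord 1) ^+ s * _ in gr *.
  set v := (w ^+ m * w' ^+ m'); have v0 : 0 <= v by rewrite mulr_ge0 ?exprn_ge0.
  rewrite [leRHS](_ : _ = n.+1%:R ^+ 4 * (X * X')%:R * v * (1000 ^+ r * z)); last first.
    move: ((X * X')%:R : R) (n.+1%:R ^+ 4 : R) (1000 ^+ r : R) => t t' t''; ring.
  by rewrite ler_peMr // !mulr_ge0 ?exprn_ge0.
rewrite [leRHS](_ : _ = n.+1%:R ^+ 4 * 1000 ^+ r * (#|F|%:R *+ 2)); last first.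
  move: (#|F|%:R : R) (n.+1%:R ^+ 4 : R) (1000 ^+ r : R) => t t' t''; ring.
apply: ler_wpM2l; first by apply: mulr_ge0; apply: exprn_ge0; exact: ler0n.
by apply: le_trans le2F; apply: ler_wpM2r => //; rewrite ler_nat.
Qed.

(** [w] and [w'] are the units held by a block of [N] elements at the two ends of an interval of
    densities. *)
Definition covered (N w w' : nat) : Prop :=
  exists G2 G1 G0 p a b c a' b' c',
  [/\ weights_ok G2 G1 G0 p, block_ok G2 G1 G0 a b c & block_ok G2 G1 G0 a' b' c'] /\
  [/\ (a + b + c = N)%N, (a' + b' + c' = N)%N, (a.*2 + b = w)%N & (a'.*2 + b' = w')%N].

(** Exchanging a block of weight [w] for one of weight [w'] adds [w' - w] units. Euclidean division
    gives the number of exchanges, and the remainder goes to extra elements of colour 1. *)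
Lemma covered_bound n (F : {set {set 'I_n}}) K N w w' M r :
  optimal R F -> (1 < n)%N -> covered N w w' -> (w < w' < w + N)%N ->
  (n = M * N + r)%N -> (N <= r)%N ->
  (w * M <= (2 ^ K).*2 - 2 <= w' * M)%N ->
  rho ^+ (M * N) <= 2 * n.+1%:R ^+ 4 * 1000 ^+ r * #|F|%:R.
Proof.
move=> optF n1 [G2 [G1 [G0 [p [a [b [c [a' [b' [c' [[wok bok bok'] [abc abc' aw aw']]]]]]]]]]]].
move=> /andP[ww' w'N] nE Nr /andP[wX Xw'].
set X := ((2 ^ K).*2 - 2)%N in wX Xw'.
pose m' := ((X - w * M) %/ (w' - w))%N; pose s := ((X - w * M) %% (w' - w))%N.
have XE : (X - w * M = m' * (w' - w) + s)%N by apply: divn_eq.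
have sw : (s < w' - w)%N by rewrite ltn_mod subn_gt0.
have mM : (m' <= M)%N.
  rewrite -ltnS ltn_divLR ?subn_gt0 //; nia.
(* The additional unit in [s.+1] and the unit of the tail make up the 2 subtracted in [X]. *)
have := interpolated_bound (K := K) (m := M - m') (m' := m') (r := r) (s := s.+1)
  optF n1 wok bok bok' abc abc'.
rewrite -mulnDl subnK // aw aw' => -> //; first by lia.
have K0 : (0 < 2 ^ K)%N by rewrite expn_gt0.
have : ((M - m') * w + m' * w' + s = X)%N.
  rewrite -{1}(subnKC (ltnW ww')) mulnDr addnA -mulnDl subnK // -addnA -XE mulnC.
  exact: subnKC.
rewrite expnS.
by rewrite /X; lia.
Qed.

Lemma covered_57_76 : covered 150 57 76.
Proof.
(* Weights in millionths and [u] in hundredths, with both inequalities of [hit_count] nearly tight,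
   then the two blocks. At this end of the octave colour 2 is rare. *)
exists 12000%num, 527500%num, 706500%num, 182%num,
  1%N, 55%N, 94%N, 2%N, 72%N, 76%N.
by split; split; vm_compute.
Qed.

Lemma covered_76_82 : covered 150 76 82.
Proof.
(* In the three middle certificates the exponential rate at each end exceeds the logarithm of 1.236
   by less than 10^-4, hence the short intervals. *)
exists 115000%num, 421156%num, 700440%num, 164%num,
  13%N, 50%N, 87%N, 15%N, 52%N, 83%N.
by split; split; vm_compute.
Qed.

Lemma covered_82_83 : covered 150 82 83.
Proof.
exists 165000%num, 349983%num, 721089%num, 162%num,
  20%N, 42%N, 88%N, 20%N, 43%N, 87%N.
by split; split; vm_compute.
Qed.

Lemma covered_83_86 : covered 150 83 86.
Proof.
exists 194000%num, 308778%num, 733369%num, 161%num,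
  23%N, 37%N, 90%N, 24%N, 38%N, 88%N.
by split; split; vm_compute.
Qed.

Lemma covered_86_114 : covered 150 86 114.
Proof.
(* Towards 114, twice 57, colour 2 has replaced colour 1, of which a little remains because
   [block_ok] asks for a positive [b]. *)
exists 405000%num, 17411%num, 820192%num, 155%num,
  42%N, 2%N, 106%N, 56%N, 2%N, 92%N.
by split; split; vm_compute.
Qed.

End Assembly.

(** * The lower bound for every [n] *)

Section Final.
Variable R : realType.
Local Notation rho := (1236 / 1000 : R).

(** One element of colour 1 and a tail formed by the others is an instance with [K = 0], which some
    query must split. *)
Lemma optimal_card_gt0 n (F : {set {set 'I_n}}) :
  optimal R F -> (1 < n)%N -> (0 < #|F|)%N.
Proof.
move=> optF n1; pose x0 := Ordinal n1.
have [||Q QF _] := optimal_hit (K := 0) (f := colouring (set0, [set x0])) optF n1.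
- by exists (Ordinal (ltnW n1)); rewrite colouringE /= !inE.
- rewrite (bigD1 x0) //= big1 => [|i ix]; rewrite colouringE /= !inE ?eqxx //.
  by rewrite (negbTE ix).
by apply/card_gt0P; exists Q.
Qed.

(** With the next [K] the middle quantity [X] becomes [2 * X + 2], so the least [K] reaching
    [57 * M] cannot overshoot [114 * M]. *)
Lemma power_of_two_window M : (0 < M)%N ->
  exists K, (57 * M <= (2 ^ K).*2 - 2 <= 114 * M)%N.
Proof.
move=> M0; have ex : exists K, (57 * M <= (2 ^ K).*2 - 2)%N.
  exists (57 * M)%N; have := ltn_expl (57 * M) (isT : (1 < 2)%N); lia.
case: (ex_minnP ex) => -[|K] K1 Kmin; first by move: K1; rewrite expn0; lia.
exists K.+1; rewrite K1 /=; have := Kmin K; rewrite ltnn expnS.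
case: (leqP (57 * M) ((2 ^ K).*2 - 2)) => [_ /(_ isT)//|]; lia.
Qed.

(** At least [N] elements are held back, to have room for the remainder in [covered_bound]. *)
Lemma split_off_remainder N n : (0 < N)%N -> (2 * N <= n)%N ->
  exists M r, [/\ n = (M * N + r)%N, (0 < M)%N & (N <= r < 2 * N)%N].
Proof.
move=> N0 Nn; have := divn_eq n N; have := ltn_pmod n N0.
have : (2 <= n %/ N)%N by rewrite leq_divRL.
move: (n %/ N)%N (n %% N)%N => [//|M] t M2 tN ->.
exists M, (N + t)%N; rewrite mulSnr -addnA; split=> //.
by rewrite leq_addr mul2n -addnn ltn_add2l.
Qed.

(** With blocks of 150 elements, [r < 300] and [rho <= 2], so [2000 ^+ 300] absorbs
    [1000 ^+ r * rho ^+ r]; it also settles [n < 300]. *)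
Lemma optimal_lower_bound n (F : {set {set 'I_n}}) :
  optimal R F -> (1 < n)%N ->
  rho ^+ n <= 2 * 2000 ^+ 300 * n.+1%:R ^+ 4 * #|F|%:R.
Proof.
move=> optF n1.
have F1 : 1 <= #|F|%:R :> R by rewrite (ler_nat R 1) (optimal_card_gt0 optF).
have n41 : 1 <= n.+1%:R ^+ 4 :> R by apply: exprn_ege1; rewrite (ler_nat R 1).
have rho1 : 1 <= rho by lra.
have rho2 : rho <= 2 by lra.
have rho_le k : rho ^+ k <= 2 ^+ k.
  by apply: lerXn2r; [exact: ltW (rho_gt0 R) | exact: ler0n | exact: rho2].
have [n300|n300] := ltnP n 300.
  rewrite -mulrA -[leLHS]mulr1; apply: ler_pM.
  - exact: rho_exp_ge0.
  - exact: ler01.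
  - apply: (le_trans (rho_le n)).
    apply: (@le_trans _ _ (2 ^+ 300)); first by apply: ler_weXn2l (ltnW n300); rewrite ler1n.
    apply: (@le_trans _ _ (2000 ^+ 300)); first by apply: lerXn2r; rewrite ?nnegrE ?ler0n ?ler_nat.
    by apply: ler_peMl; rewrite ?exprn_ge0 ?ler0n ?ler1n.
  - by rewrite mulr_ege1.
have [M [r [nr M0 /andP[rlo rhi]]]] :=
  split_off_remainder (isT : (0 < 150)%N) n300.
have [K /andP[Klo Khi]] := power_of_two_window M0.
have bound : rho ^+ (M * 150) <= 2 * n.+1%:R ^+ 4 * 1000 ^+ r * #|F|%:R.
  set X := ((2 ^ K).*2 - 2)%N in Klo Khi.
  (* The five certified intervals meet end to end. *)
  have [X1|X1] := leqP X (76 * M).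
    by apply: (covered_bound (K := K) optF n1 covered_57_76 _ nr rlo) => //;
      rewrite -/X ?Klo ?Khi ?andbT.
  have [X2|X2] := leqP X (82 * M).
    by apply: (covered_bound (K := K) optF n1 covered_76_82 _ nr rlo) => //;
      rewrite -/X ?(ltnW X1) ?Khi ?andbT.
  have [X3|X3] := leqP X (83 * M).
    by apply: (covered_bound (K := K) optF n1 covered_82_83 _ nr rlo) => //;
      rewrite -/X ?(ltnW X2) ?Khi ?andbT.
  have [X4|X4] := leqP X (86 * M).
    by apply: (covered_bound (K := K) optF n1 covered_83_86 _ nr rlo) => //;
      rewrite -/X ?(ltnW X3) ?Khi ?andbT.
  by apply: (covered_bound (K := K) optF n1 covered_86_114 _ nr rlo) => //;
      rewrite -/X ?(ltnW X4) ?Khi ?andbT.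
rewrite {1}nr exprD.
apply: le_trans (ler_pM (rho_exp_ge0 _ _) (rho_exp_ge0 _ _) bound (rho_le r)) _.
have r2000 : 1000 ^+ r * 2 ^+ r <= 2000 ^+ 300 :> R.
  rewrite -exprMn -natrM; apply: ler_weXn2l (ltnW rhi).
  by rewrite ler1n.
rewrite [leLHS](_ : _ = 2 * n.+1%:R ^+ 4 * #|F|%:R * (1000 ^+ r * 2 ^+ r)); last first.
  move: (#|F|%:R : R) (n.+1%:R ^+ 4 : R) (1000 ^+ r : R) (2 ^+ r : R) => t t' t'' t'''; ring.
rewrite [leRHS](_ : _ = 2 * n.+1%:R ^+ 4 * #|F|%:R * 2000 ^+ 300); last first.
  move: (#|F|%:R : R) (n.+1%:R ^+ 4 : R) (2000 ^+ 300 : R) => t t' t''; ring.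
by apply: ler_wpM2l r2000; rewrite !mulr_ge0 ?exprn_ge0 ?ler0n.
Qed.

End Final.

(** * Asymptotic form *)

Local Open Scope classical_set_scope.
Local Open Scope ring_scope.

(** By [ln t <= t - 1] at [t = d * n.+1], the logarithm is at most [d * n] plus a constant, for any
    [d > 0]; here [d] is small enough for [B] to use up only half of [eps]. *)
Lemma ln_affine_littleo (R : realType) (A B : R) :
  (fun n : nat => A + B * ln n.+1%:R) =o_\oo (fun n : nat => n%:R : R).
Proof.
apply/eqoP => eps eps0.
pose d := eps / (2 * (`|B| + 1)).
have B0 : 0 <= `|B| := normr_ge0 B.
have d0 : 0 < d by apply: divr_gt0 => //; lra.
pose C := `|A| + `|B| * `|d - 1 - ln d|.
have bnd n : `|A + B * ln n.+1%:R| <= C + eps / 2 * n%:R.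
  have n0 : 0 <= n%:R :> R := ler0n _ _.
  have y1 : 1 <= n.+1%:R :> R by rewrite (ler_nat R 1).
  have l0 : 0 <= ln n.+1%:R :> R by apply: ln_ge0.
  have le : ln n.+1%:R <= `|d - 1 - ln d| + d * n%:R.
    have := @le_ln1Dx R (d * n.+1%:R - 1).
    have dy : 0 < d * n.+1%:R by rewrite mulr_gt0 ?ltr0n.
    rewrite addrCA subrr addr0 lnM ?posrE ?ltr0n // ltrBrDr addNr => /(_ dy).
    have := ler_norm (d - 1 - ln d); rewrite -(natr1 n) mulrDr mulr1.
    set t := ln _; set t' := `|_|; lra.
  apply: (le_trans (ler_normD _ _)); rewrite normrM (ger0_norm l0) /C -addrA lerD2l.
  apply: le_trans (ler_wpM2l B0 le) _; rewrite mulrDr lerD2l mulrA ler_wpM2r //.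
  rewrite /d mulrA ler_pdivrMr; last by lra.
  by have := mulr_ge0 (ltW eps0) B0; nra.
near=> n.
apply: (le_trans (bnd n)); rewrite ger0_norm ?ler0n //.
have : C / (eps / 2) <= n%:R by near: n; apply: nbhs_infty_ger.
by rewrite ler_pdivrMr ?divr_gt0 //; lra.
Unshelve. all: by end_near.
Qed.

Theorem theorem5p3 (R : realType) :
  exists2 e : nat -> R,
    e =o_\oo (fun n : nat => n%:R : R) &
    forall n : nat, (2 <= n)%N ->
      (1236 / 1000 : R) `^ (n%:R - e n) <= (q R n)%:R.
Proof.
set rho : R := 1236 / 1000; pose K : R := 2 * 2000 ^+ 300.
have rho1 : 1 < rho by rewrite /rho; lra.
have lr : 0 < ln rho by apply: ln_gt0.
have K0 : 0 < K by apply: mulr_gt0; rewrite ?exprn_gt0 ?ltr0n.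
(* This is the logarithm of [K * n.+1 ^ 4] in base [rho], so subtracting it from the exponent
   divides by the factor of [optimal_lower_bound]. *)
exists (fun n => ln K / ln rho + 4 / ln rho * ln n.+1%:R).
  exact: ln_affine_littleo.
move=> n n2; rewrite /q; case: ex_minnP => m /asboolP[F optF <-] _.
have := optimal_lower_bound optF n2; rewrite -/rho -/K => bound.
have rho0 : 0 < rho by apply: lt_trans rho1.
have -> : ln K / ln rho + 4 / ln rho * ln n.+1%:R = ln (K * n.+1%:R ^+ 4) / ln rho.
  rewrite lnM ?posrE ?exprn_gt0 ?ltr0n // lnXn ?ltr0n // -[_ *+ 4]mulr_natl.
  by field; rewrite gt_eqF.
have KN0 : 0 < K * n.+1%:R ^+ 4 by rewrite mulr_gt0 ?exprn_gt0 ?ltr0n.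
rewrite powRB; last by rewrite (gt_eqF rho0) implybT.
rewrite powR_mulrn ?(ltW rho0) // /powR (gt_eqF rho0).
rewrite divfK ?gt_eqF // lnK ?posrE //.
by rewrite ler_pdivrMr // mulrC.
Qed.
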